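(* Let $n\ge2$ and let $F_\Sigma:\Sigma\to\mathbb{R}^{n+1}$ be a pinching cylinder with profile function $\omega_\Sigma:\mathbb{R}\to[0,\infty)$ having exactly one pinching point ($n_p=1$), located at $w_1=z^*=0$, satisfying the graph condition $\langle\nu_\Sigma(z),e_1\rangle>C_\Sigma\ge0$ for a constant $C_\Sigma$ (understood, at $z=0$, as limits from the left and from the right), and $$z\,\frac{d\omega_\Sigma}{dz}(z)>0\qquad\text{for all } z\in\mathbb{R}\setminus\{0\}.$$ Then there does not exist an immersed bounded smooth minimal hypersurface $F:M^n\to\mathbb{R}^{n+1}$ supported on $F_\Sigma$.
   Context: Points of $\mathbb{R}^{n+1}$ are written $(x,z)$, $x\in\mathbb{R}^n$, $z\in\mathbb{R}$, $y=|x|$; $Oz$ is the $z$-axis. Pinching cylinder: let $\omega_\Sigma:\mathbb{R}\to[0,\infty)$ be continuous, and smooth outside a finite set $P=\{w_1,\dots,w_{n_p}\}$ of points with $\omega_\Sigma(w_i)=0$. Assume there is a compact set $K\supset P$ such that $z\frac{d\omega_\Sigma}{dz}(z)>0$ for all $z\in\mathbb{R}\setminus K$. The function $\omega_\Sigma$ generates, by rotation about $Oz$, the smooth disconnected rotationally symmetric hypersurface $F_\Sigma(\Sigma)=\{(x,z):|x|=\omega_\Sigma(z),\ z\notin P\}$, a disjoint union of $n_p+1$ cylinders, called a pinching cylinder. In the profile plane with coordinates $(y,z)$, its unit normal, pointing away from the interior of the hypersurfaces supported on it, is $\nu_\Sigma=\frac{1}{\sqrt{1+(\omega_\Sigma')^2}}(1,-\omega_\Sigma')$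 and $e_1=(1,0)$ is the direction of the $y$-axis. Minimal hypersurface supported on (i.e. with free boundary on) $F_\Sigma$: a smooth immersion $F:M^n\to\mathbb{R}^{n+1}$ of an $n$-dimensional manifold $M$ with boundary $\partial M$, with mean curvature $H\equiv0$, $F(\partial M)\subset F_\Sigma(\Sigma)$ and $\langle\nu,\nu_\Sigma\rangle=0$ along $\partial M$, where $\nu$ is the unit normal of $F$. No assumption on topology, symmetry or graphicality is made. Bounded means that $F(M)$ is a bounded set.
   Formalization: The formal theorem also assumes that M is non-empty and that the image F(M) is closed (automatic for compact M or proper F); without closedness the claim is false, e.g. a small open flat disc with empty boundary is bounded, minimal and vacuously supported on F_Σ. *)

(* Defs.v *)
From HB Require Import structures.
From mathcomp Require Import all_boot all_order all_algebra.
From mathcomp Require Import all_classical all_reals all_analysis.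

Set Implicit Arguments.
Unset Strict Implicit.
Unset Printing Implicit Defensive.

Import Order.TTheory GRing.Theory Num.Theory.
Import numFieldNormedType.Exports.

Local Open Scope classical_set_scope.
Local Open Scope ring_scope.

(* The norm of the normed module 'rV_m is the sup norm; lengths and angles
   below are Euclidean and go through [dotv] and [enorm]. *)
Definition dotv (R : realType) (m : nat) (u v : 'rV[R]_m) : R :=
  (u *m v^T) 0 0.

Definition enorm (R : realType) (m : nat) (u : 'rV[R]_m) : R :=
  Num.sqrt (dotv u u).

(* A point of R^(n+1) is (x, z) with x its first n coordinates. *)
Definition xpart (R : realType) (n : nat) (X : 'rV[R]_(n + 1)) : 'rV[R]_n :=
  lsubmx X.

Definition zpart (R : realType) (n : nat) (X : 'rV[R]_(n + 1)) : R :=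
  rsubmx X 0 0.

(* C^oo on the open set U: all iterated directional derivatives are
   differentiable at every point of U. *)
Definition smooth_on (R : realType) (V W : normedModType R) (U : set V)
    (f : V -> W) : Prop :=
  forall (s : seq V) (x : V), U x ->
    differentiable (foldr (fun v h => 'D_v h) f s) x.

(* g is a C^oo function on a neighbourhood of x which extends f|_A near x. *)
Definition smooth_extension (R : realType) (V W : normedModType R) (A : set V)
    (f : V -> W) (x : V) (g : V -> W) : Prop :=
  exists O : set V, [/\ open O, O x, smooth_on O g &
    forall y, O y -> A y -> g y = f y].

Definition smooth_within (R : realType) (V W : normedModType R) (A : set V)
    (f : V -> W) : Prop :=
  forall x, A x -> exists g, smooth_extension A f x g.

(* The closed half-space {u_0 >= 0} of R^n and its boundary {u_0 = 0}; for
   n = 0 these are the point and the empty set. *)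
Definition half_space (R : realType) (n : nat) : set 'rV[R]_n :=
  [set u | forall i : 'I_n, val i = 0%N -> 0 <= u 0 i].

Definition half_space_boundary (R : realType) (n : nat) : set 'rV[R]_n :=
  [set u | exists2 i : 'I_n, val i = 0%N & u 0 i = 0].

(* [chart_inv] is meaningful only on the image of [chart_dom]. *)
Record chart (R : realType) (n : nat) (M : topologicalType) := Chart {
  chart_dom : set M ;
  chart_map : M -> 'rV[R]_n ;
  chart_inv : 'rV[R]_n -> M ;
  chart_dom_open : open chart_dom ;
  chart_map_continuous : {within chart_dom, continuous chart_map} ;
  chart_image_open : exists2 O : set 'rV[R]_n, open O &
    chart_map @` chart_dom = O `&` @half_space R n ;
  chart_mapK : forall p, chart_dom p -> chart_inv (chart_map p) = p ;
  chart_inv_continuous :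
    {within chart_map @` chart_dom, continuous chart_inv}
}.

Definition chart_image (R : realType) (n : nat) (M : topologicalType)
    (c : chart R n M) (A : set M) : set 'rV[R]_n :=
  chart_map c @` (chart_dom c `&` A).

(* Smooth n-dimensional manifolds with (possibly empty) boundary; the atlas
   need not be maximal. *)
Record manifold_with_boundary (R : realType) (n : nat) := Manifold {
  carrier :> topologicalType ;
  atlas : set (chart R n carrier) ;
  manifold_hausdorff : hausdorff_space carrier ;
  manifold_second_countable : @second_countable carrier ;
  atlas_cover : forall p, exists2 c, atlas c & chart_dom c p ;
  atlas_compatible : forall c d, atlas c -> atlas d ->
    smooth_within (chart_image c (chart_dom d)) (chart_map d \o chart_inv c)
}.

Definition manifold_boundary (R : realType) (n : nat)
    (M : manifold_with_boundary R n) : set M :=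
  [set p | exists c : chart R n M, [/\ atlas c, chart_dom c p &
    half_space_boundary (chart_map c p)]].

Section Hypersurface.
Variables (R : realType) (n : nat) (M : manifold_with_boundary R n).
Variable F : M -> 'rV[R]_(n + 1).

(* g represents F near p in the chart c.  At a boundary point g extends F
   across the boundary of the half-space; by continuity the derivatives of g
   at chart_map c p do not depend on the extension. *)
Definition local_param (c : chart R n M) (p : M)
    (g : 'rV[R]_n -> 'rV[R]_(n + 1)) : Prop :=
  [/\ atlas c, chart_dom c p &
    smooth_extension (chart_image c setT) (F \o chart_inv c)
      (chart_map c p) g].

Definition smooth_map : Prop :=
  forall c : chart R n M, atlas c ->
    smooth_within (chart_image c setT) (F \o chart_inv c).

Definition immersion : Prop :=
  smooth_map /\
  forall c p g, local_param c p g -> row_free ('J g (chart_map c p)).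

Definition unit_normal_in (g : 'rV[R]_n -> 'rV[R]_(n + 1)) (u : 'rV[R]_n)
    (nu : 'rV[R]_(n + 1)) : Prop :=
  dotv nu nu = 1 /\ forall v, dotv (v *m 'J g u) nu = 0.

(* The unit normal at p is determined up to sign. *)
Definition unit_normal (p : M) (nu : 'rV[R]_(n + 1)) : Prop :=
  exists c g, local_param c p g /\ unit_normal_in g (chart_map c p) nu.

Definition first_form (g : 'rV[R]_n -> 'rV[R]_(n + 1)) (u : 'rV[R]_n) :
    'M[R]_n :=
  'J g u *m ('J g u)^T.

Definition second_form (g : 'rV[R]_n -> 'rV[R]_(n + 1)) (u : 'rV[R]_n)
    (nu : 'rV[R]_(n + 1)) : 'M[R]_n :=
  \matrix_(i, j)
    dotv ('D_(delta_mx 0 i) ('D_(delta_mx 0 j) g) u) nu.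

Definition mean_curvature (g : 'rV[R]_n -> 'rV[R]_(n + 1)) (u : 'rV[R]_n)
    (nu : 'rV[R]_(n + 1)) : R :=
  \tr (invmx (first_form g u) *m second_form g u nu).

Definition minimal_hypersurface : Prop :=
  immersion /\
  forall c p g nu, local_param c p g ->
    unit_normal_in g (chart_map c p) nu ->
    mean_curvature g (chart_map c p) nu = 0.

End Hypersurface.

(* P lists the pinching points.  They are all the zeros of omega, as the
   rotated graph over the complement of P is a union of cylinders. *)
Definition pinching_cylinder (R : realType) (P : seq R) (omega : R -> R) :
    Prop :=
  [/\ uniq P,
      continuous omega,
      (forall z, 0 <= omega z) /\ (forall z, omega z = 0 <-> z \in P),
      smooth_on (~` [set` P]) omega &
      exists K : set R, [/\ compact K, [set` P] `<=` K &
        forall z, ~ K z -> 0 < z * derive1 omega z]].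

Definition cylinder_surface (R : realType) (n : nat) (P : seq R)
    (omega : R -> R) : set 'rV[R]_(n + 1) :=
  [set X | enorm (xpart X) = omega (zpart X) /\ zpart X \notin P].

(* The normal in the (y, z) profile plane. *)
Definition profile_normal (R : realType) (omega : R -> R) (z : R) :
    'rV[R]_(1 + 1) :=
  (Num.sqrt (1 + derive1 omega z ^+ 2))^-1 *: row_mx 1%:M (- derive1 omega z)%:M.

Definition profile_e1 (R : realType) : 'rV[R]_(1 + 1) := row_mx 1%:M 0.

(* The normal of the rotated surface at X = (x, z): the y-direction of the
   profile plane through X is x / |x|. *)
Definition cylinder_normal (R : realType) (n : nat) (omega : R -> R)
    (X : 'rV[R]_(n + 1)) : 'rV[R]_(n + 1) :=
  let nu := profile_normal omega (zpart X) in
  row_mx (lsubmx nu 0 0 *: ((enorm (xpart X))^-1 *: xpart X)) (rsubmx nu).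

(* At a pinching point the condition bears on the one-sided limits. *)
Definition graph_condition (R : realType) (P : seq R) (omega : R -> R)
    (C : R) : Prop :=
  let f z := dotv (profile_normal omega z) (@profile_e1 R) in
  (forall z, z \notin P -> C < f z) /\
  (forall w, w \in P ->
    (exists2 l, f z @[z --> w^'-] --> l & C < l) /\
    (exists2 l, f z @[z --> w^'+] --> l & C < l)).

Definition supported_on_cylinder (R : realType) (n : nat) (P : seq R)
    (omega : R -> R) (M : manifold_with_boundary R n)
    (F : M -> 'rV[R]_(n + 1)) : Prop :=
  F @` @manifold_boundary R n M `<=` @cylinder_surface R n P omega /\
  forall p nu, @manifold_boundary R n M p -> unit_normal F p nu ->
    dotv nu (cylinder_normal omega (F p)) = 0.

(* Main.v *)
Require Import Defs.
From HB Require Import structures.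
From mathcomp Require Import all_boot all_order all_algebra.
From mathcomp Require Import all_classical all_reals all_analysis.
From mathcomp Require Import ring lra.

(** For every constant c the function |x|^2 + c z is strictly subharmonic on a
    minimal hypersurface of dimension n >= 2: z is harmonic, and |x|^2 is
    strictly subharmonic because a tangent space is never contained in the
    z-axis.  Since the image of F is compact, |x|^2 + c z has a maximum on the
    hypersurface, and by [minimal_max_boundary] every such maximum is a boundary
    point; in particular the boundary is not empty.  The hypersurface itself
    need not be compact, and subharmonicity is used only in the form of a
    second-derivative test at the maximum ([minimal_no_interior_max]).

    Let p be a maximum of |x|^2; it lies on the cylinder with z(p) nonzero.
    Put s = sign z(p).  As |x| = omega(z) on the boundary and omega is strictly
    increasing in |z| on each side of 0, the function s z restricted to the
    boundary is maximal at p.  Letting c tend to s * infinity in the maximum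
    principle, s z is maximal at p over the whole hypersurface.

    By the free boundary condition the cylinder normal
    N = k (x / |x|, - omega'(z)), k > 0, is tangent to the hypersurface at p
    ([normal_orthogonal_tangent]).  The derivative of |x|^2 along N is
    2 k |x| > 0, and that of s z is - k s omega'(z) < 0.  If N does not point
    out of the hypersurface, the first contradicts the maximality of |x|^2 at p;
    otherwise - N points inward and the second contradicts the maximality of
    s z ([boundary_max_derive_le0]).  No assumption on the side of the cylinder
    on which the hypersurface lies is needed. *)

Set Implicit Arguments.
Unset Strict Implicit.
Unset Printing Implicit Defensive.

Import Order.TTheory GRing.Theory Num.Theory.
Import numFieldNormedType.Exports.

Local Open Scope classical_set_scope.
Local Open Scope ring_scope.

(** * Euclidean inner product *)

Section Dot.
Variables (R : realType) (m : nat).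
Implicit Types u v w : 'rV[R]_m.

Lemma dotvE u v : dotv u v = \sum_k u 0 k * v 0 k.
Proof. by rewrite /dotv mxE; apply: eq_bigr => k _; rewrite mxE. Qed.

Lemma dotvC u v : dotv u v = dotv v u.
Proof. by rewrite !dotvE; apply: eq_bigr => k _; rewrite mulrC. Qed.

Lemma dotvDl u v w : dotv (u + v) w = dotv u w + dotv v w.
Proof. by rewrite /dotv mulmxDl mxE. Qed.

Lemma dotvDr u v w : dotv w (u + v) = dotv w u + dotv w v.
Proof. by rewrite !(dotvC w) dotvDl. Qed.

Lemma dotvZl a u v : dotv (a *: u) v = a * dotv u v.
Proof. by rewrite /dotv -scalemxAl mxE. Qed.

Lemma dotvZr a u v : dotv u (a *: v) = a * dotv u v.
Proof. by rewrite dotvC dotvZl dotvC. Qed.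

Lemma dotv_ge0 u : 0 <= dotv u u.
Proof. by rewrite dotvE sumr_ge0 // => k _; rewrite -expr2 sqr_ge0. Qed.

Lemma dotv_eq0 u : (dotv u u == 0) = (u == 0).
Proof.
apply/eqP/eqP => [|->]; last by rewrite /dotv mul0mx mxE.
rewrite dotvE => /eqP; rewrite psumr_eq0; last first.
  by move=> k _; rewrite -expr2 sqr_ge0.
move=> /allP u0; apply/rowP => k; apply/eqP; rewrite mxE.
by have := u0 k (mem_index_enum _); rewrite /= -expr2 sqrf_eq0.
Qed.

Lemma sqr_enorm u : enorm u ^+ 2 = dotv u u.
Proof. by rewrite sqr_sqrtr // dotv_ge0. Qed.

Lemma dotv_unit u : u != 0 ->
  dotv ((enorm u)^-1 *: u) ((enorm u)^-1 *: u) = 1.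
Proof.
move=> u0; rewrite dotvZl dotvZr mulrA -expr2 exprVn sqr_enorm mulVf //.
by rewrite dotv_eq0.
Qed.

End Dot.

Lemma dotv_mulmxl (R : realType) (m p : nat) (u : 'rV[R]_m) (A : 'M[R]_(m, p))
  (v : 'rV[R]_p) : dotv (u *m A) v = dotv u (v *m A^T).
Proof. by rewrite /dotv trmx_mul trmxK mulmxA. Qed.

(** * Traces against the inverse of a Gram matrix *)

Section Gram.
Variables (R : realType) (m p : nat) (J : 'M[R]_(m, p)).
Hypothesis Jfree : row_free J.

Lemma gram_unitmx : J *m J^T \in unitmx.
Proof.
rewrite -row_free_unit -kermx_eq0; apply/eqP/row_matrixP => i.
rewrite row0; set v := row i _.
have vG : v *m (J *m J^T) = 0 by rewrite /v -row_mul mulmx_ker row0.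
have /eqP : dotv (v *m J) (v *m J) = 0.
  by rewrite dotv_mulmxl -mulmxA vG dotvE big1 // => k _; rewrite !mxE mulr0.
rewrite dotv_eq0 => /eqP vJ.
by apply/eqP; rewrite -(mulmx_free_eq0 v Jfree) vJ.
Qed.

(* The inverse Gram matrix factors as [K *m K^T], so traces against it are
   sums of values of quadratic forms at the columns of K. *)
Let K := invmx (J *m J^T) *m J.

Lemma inv_gram_sym : (invmx (J *m J^T))^T = invmx (J *m J^T).
Proof. by rewrite trmx_inv trmx_mul trmxK. Qed.

Lemma mxtrace_inv_gram (S : 'M[R]_m) :
  \tr (invmx (J *m J^T) *m S) =
  \sum_j (row j K^T *m S *m (row j K^T)^T) 0 0.
Proof.
have -> : invmx (J *m J^T) *m S = K *m (K^T *m S).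
  rewrite /K trmx_mul inv_gram_sym !mulmxA -(mulmxA _ J) mulVmx ?gram_unitmx //.
  by rewrite mul1mx.
rewrite mxtrace_mulC /mxtrace; apply: eq_bigr => j _.
rewrite -row_mul [LHS]mxE [RHS]mxE; apply: eq_bigr => k _.
by rewrite [(row _ _) 0 k]mxE [_^T k _]mxE [row _ _ 0 k]mxE [K^T _ _]mxE.
Qed.

Lemma mxtrace_inv_gram_le0 (S : 'M[R]_m) :
  (forall v : 'rV_m, (v *m S *m v^T) 0 0 <= 0) ->
  \tr (invmx (J *m J^T) *m S) <= 0.
Proof.
by move=> S0; rewrite mxtrace_inv_gram sumr_le0 // => j _; exact: S0.
Qed.

Lemma mxtrace_inv_gram_gt0 (q : nat) (A : 'M[R]_(m, q)) : A != 0 ->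
  0 < \tr (invmx (J *m J^T) *m (A *m A^T)).
Proof.
move=> A0.
have quad (v : 'rV_m) : (v *m (A *m A^T) *m v^T) 0 0 = dotv (v *m A) (v *m A).
  by rewrite /dotv trmx_mul !mulmxA.
rewrite mxtrace_inv_gram lt_def sumr_ge0 ?andbT; last first.
  by move=> j _; rewrite quad dotv_ge0.
apply: contra A0; rewrite psumr_eq0; last first.
  by move=> j _; rewrite quad dotv_ge0.
move=> /allP K0; have KA : K^T *m A = 0.
  apply/row_matrixP => j; rewrite row0 row_mul; apply/eqP.
  by rewrite -dotv_eq0 -quad; apply: (K0 j (mem_index_enum _)).
have : J *m (K^T *m A) = A.
  rewrite /K trmx_mul inv_gram_sym !mulmxA mulmxV ?gram_unitmx //.
  by rewrite mul1mx.
by rewrite KA mulmx0 => <-.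
Qed.

End Gram.

(** * Derivatives along lines and at maxima *)

Section Calculus.
Variables (R : realType) (V : normedModType R).

Lemma is_derive_rV (m : nat) (f : V -> 'rV[R]_m) (df : 'rV[R]_m) x v :
  is_derive x v f df <->
  forall k, is_derive x v (fun y => f y 0 k) (df 0 k).
Proof.
split=> [[fd <-] k|fd].
  have /derivable_mxP/(_ 0 k) fk := fd.
  by rewrite derive_mx // mxE; exact: derivableP.
have fdr : derivable f x v.
  by apply/derivable_mxP => i k; rewrite (ord1 i); exact: ex_derive.
apply: DeriveDef => //; rewrite derive_mx //; apply/rowP => k; rewrite mxE.
exact: derive_val.
Qed.

Lemma is_derive_dotv (m : nat) (f g : V -> 'rV[R]_m) (df dg : 'rV[R]_m) x v :
  is_derive x v f df -> is_derive x v g dg ->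
  is_derive x v (fun y => dotv (f y) (g y)) (dotv df (g x) + dotv (f x) dg).
Proof.
move=> /is_derive_rV fd /is_derive_rV gd.
have -> : (fun y => dotv (f y) (g y)) =
    \sum_(k < m) ((fun y => f y 0 k) * (fun y => g y 0 k)).
  by apply/funext => y; rewrite dotvE fct_sumE.
rewrite !dotvE -big_split /=.
apply: is_derive_sum => k.
apply: is_derive_eq.
by rewrite addrC [_ *: df 0 k]mulrC.
Qed.

Lemma is_derive_mulmxr (m p : nat) (f : V -> 'rV[R]_m) (df : 'rV[R]_m)
    (A : 'M[R]_(m, p)) x v :
  is_derive x v f df -> is_derive x v (fun y => f y *m A) (df *m A).
Proof.
move=> /is_derive_rV fd; apply/is_derive_rV => k.
have -> : (fun y => (f y *m A) 0 k) =
    \sum_(j < m) (A j k *: (fun y => f y 0 j)).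
  apply/funext => y; rewrite mxE fct_sumE.
  by apply: eq_bigr => j _; rewrite mulrC.
rewrite mxE; apply: is_derive_sum => j.
by apply: is_derive_eq; rewrite [RHS]mulrC.
Qed.

Lemma is_derive_line (W : normedModType R) (f : V -> W) (df : W) x v (t : R) :
  is_derive (t *: v + x) v f df -> is_derive t 1 (fun s => f (s *: v + x)) df.
Proof.
have E : (fun h : R => h^-1 *:
    (((fun s : R => f (s *: v + x)) \o shift t) (h *: (1 : R))
      - f (t *: v + x))) =
  (fun h => h^-1 *: ((f \o shift (t *: v + x)) (h *: v) - f (t *: v + x))).
  by apply/funext => h /=; rewrite [h *: 1]mulr1 scalerDl addrA.
by move=> [fd fv]; apply: DeriveDef; rewrite /derivable /derive E.
Qed.

Lemma cvg_line (x v : V) : (fun t : R => t *: v + x) @ 0 --> x.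
Proof.
have : (fun t : R => t *: v + x) @ 0 --> 0 *: v + x.
  by apply: cvgD; [apply: cvgZr_tmp; exact: cvg_id|exact: cvg_cst].
by rewrite scale0r add0r.
Qed.

Lemma derive_le0_right (f : V -> R) (d : R) x v :
  is_derive x v f d ->
  (\forall t \near 0^'+, f (t *: v + x) <= f x) -> d <= 0.
Proof.
move=> [fd <-] fle; rewrite /derive cvg_at_rightE //.
apply: limr_le.
  rewrite -(cvg_at_rightE
    (fun h : R => h^-1 *: ((f \o shift x) (h *: v) - f x))) //.
  apply: cvg_trans fd; apply: cvg_app.
  move=> A [e e0 Ae]; exists e => // y ye y0.
  by apply: Ae => //; exact: lt0r_neq0.
near=> h; apply: mulr_ge0_le0; first by rewrite invr_ge0.
by rewrite subr_le0; near: h.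
Unshelve. all: by end_near. Qed.

End Calculus.

(** If [s] were positive, [g] would be positive and [f] increasing on a right
    neighbourhood of 0. *)
Lemma second_derive_le0 (R : realType) (f g : R -> R) (s : R) :
  (\forall t \near (0 : R), is_derive (t : R) 1 f (g t)) ->
  is_derive (0 : R) 1 g s -> g 0 = 0 ->
  (\forall t \near (0 : R), f t <= f 0) -> s <= 0.
Proof.
move=> fd gd g0 fle; rewrite leNgt; apply/negP => s0.
have gpos : \forall t \near 0^'+, 0 < g t.
  have : h^-1 *: ((g \o shift 0) (h *: (1:R)) - g 0) @[h --> 0^'] --> s.
    by case: gd => [gd <-].
  move=> /cvgrPdist_lt/(_ s s0) [e /= e0 He].
  exists e => //= t te t0; have := He t te (lt0r_neq0 t0).
  rewrite /= g0 subr0 addr0 [t *: 1]mulr1 => H.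
  have : 0 < t^-1 *: g t.
    by move: H; rewrite ltr_distlC subrr => /andP[].
  by rewrite [_ *: _]mulrC pmulr_lgt0 // invr_gt0.
case: fd => e1 /= e10 fd; case: fle => e2 /= e20 fle.
case: gpos => e3 /= e30 gpos.
pose e := Num.min e1 (Num.min e2 e3); pose b := e / 2.
have e0 : 0 < e by rewrite !lt_min e10 e20 e30.
have b0 : 0 < b by rewrite divr_gt0.
have be : b < e by rewrite /b ltr_pdivrMr // ltr_pMr // ltr1n.
have small t : 0 <= t -> t <= b -> `|0 - t| < e.
  by move=> t0 tb; rewrite sub0r normrN ger0_norm // (le_lt_trans tb).
have dE t : 0 <= t -> t <= b -> is_derive t 1 f (g t).
  move=> t0 tb; apply: fd; apply: lt_le_trans (small _ t0 tb) _.
  by rewrite ge_min lexx.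
have : f 0 < f b.
  apply: (@gtr0_derive1_lt_cc R f 0 b); rewrite ?in_itv /= ?lexx ?(ltW b0) //.
  - by move=> x; rewrite in_itv /= => /andP[/ltW x0 /ltW xb];
      case: (dE x x0 xb).
  - move=> x; rewrite in_itv /= => /andP[x0 /ltW xb]; rewrite derive1E.
    have [_ ->] := dE x (ltW x0) xb; apply: gpos => //=.
    by apply: lt_le_trans (small _ (ltW x0) xb) _; rewrite !ge_min lexx !orbT.
  - apply: derivable_within_continuous => x; rewrite in_itv /= => /andP[x0 xb].
    by case: (dE x x0 xb).
rewrite ltNge; apply/negP; rewrite negbK; apply: fle => /=.
by apply: lt_le_trans (small _ (ltW b0) (lexx _)) _; rewrite !ge_min lexx !orbT.
Qed.

(** * Quadratic functions along an immersion *)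

(** The function |X B|^2 + <X, b> on row vectors.  With B the projection onto
    the first n coordinates and b = c e_z it is |x|^2 + c z; with B = 0 it is
    linear. *)
Definition quadf (R : realType) (q r : nat) (B : 'M[R]_(q, r))
    (b X : 'rV[R]_q) : R :=
  dotv (X *m B) (X *m B) + dotv X b.

(** The Euclidean gradient 2 X B B^T + b of [quadf B b]. *)
Definition quadf_grad (R : realType) (q r : nat) (B : 'M[R]_(q, r))
    (b X : 'rV[R]_q) : 'rV[R]_q :=
  2 *: (X *m B *m B^T) + b.

Section QuadraticDerivatives.
Variables (R : realType) (V : normedModType R) (q r : nat).
Variables (B : 'M[R]_(q, r)) (b : 'rV[R]_q).

Lemma is_derive_quadf (g : V -> 'rV[R]_q) (dg : 'rV[R]_q) x v :
  is_derive x v g dg ->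
  is_derive x v (quadf B b \o g) (dotv dg (quadf_grad B b (g x))).
Proof.
move=> gd; have gB := is_derive_mulmxr B gd.
have bd : is_derive x v (cst b) 0 by exact: is_derive_cst.
have := is_deriveD (is_derive_dotv gB gB) (is_derive_dotv gd bd).
move=> /is_derive_eq; apply.
rewrite dotvDr dotvZr -dotv_mulmxl.
rewrite (dotvC (g x *m B)) mulr_natl mulr2n; congr (_ + _).
by rewrite [dotv _ 0]dotvE big1 ?addr0 // => k _; rewrite mxE mulr0.
Qed.

Lemma is_derive_quadf_grad (g dg : V -> 'rV[R]_q) (d2g : 'rV[R]_q) x v :
  is_derive x v g (dg x) -> is_derive x v dg d2g ->
  is_derive x v (fun y => dotv (dg y) (quadf_grad B b (g y)))
    (dotv d2g (quadf_grad B b (g x)) + 2 * dotv (dg x *m B) (dg x *m B)).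
Proof.
move=> gd dgd; have gB := is_derive_mulmxr B^T (is_derive_mulmxr B gd).
have bd : is_derive x v (cst b) 0 by exact: is_derive_cst.
have grd : is_derive x v (fun y => quadf_grad B b (g y))
    (2 *: (dg x *m B *m B^T)).
  have := is_deriveD (is_deriveZ 2 gB) bd.
  by move=> /is_derive_eq; apply; rewrite addr0.
have := is_derive_dotv dgd grd.
move=> /is_derive_eq; apply; congr (_ + _).
by rewrite dotvZr -dotv_mulmxl.
Qed.

End QuadraticDerivatives.

(** A pure second directional derivative is the quadratic form given by the
    second partial derivatives. *)
Lemma derive2_sum (R : realType) (m q : nat) (U : set 'rV[R]_m)
    (g : 'rV[R]_m -> 'rV[R]_q) u v : open U -> U u -> smooth_on U g ->
  'D_v ('D_v g) u = \sum_i \sum_j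
    (v 0 i * v 0 j) *: 'D_(delta_mx 0 i) ('D_(delta_mx 0 j) g) u.
Proof.
move=> Uo Uu gs.
have lin (f : 'rV[R]_m -> 'rV[R]_q) y : differentiable f y ->
    'D_v f y = \sum_j v 0 j *: 'D_(delta_mx 0 j) f y.
  move=> fd; rewrite deriveEjacobian // mulmx_sum_row; apply: eq_bigr => j _.
  by rewrite rowE deriveEjacobian.
have near_lin : \forall y \near u,
    'D_v g y = (\sum_j v 0 j *: 'D_(delta_mx 0 j) g) y.
  near=> y; rewrite lin ?fct_sumE //; apply: (gs [::]).
  by near: y; exact: open_nbhs_nbhs.
rewrite (near_eq_derive _ near_lin) derive_sum; last first.
  move=> j; apply: derivableZ; apply: diff_derivable.
  exact: (gs [:: delta_mx 0 j]).
rewrite exchange_big /=; apply: eq_bigr => j _.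
have dj : differentiable ('D_(delta_mx 0 j) g) u.
  exact: (gs [:: delta_mx 0 j]).
rewrite deriveZ; last exact: diff_derivable.
rewrite lin // scaler_sumr; apply: eq_bigr => i _.
by rewrite scalerA mulrC.
Unshelve. all: by end_near. Qed.

(** Interior maximum principle.  At a local maximum of [quadf B b] along a
    parametrized hypersurface with zero mean curvature the gradient w is
    normal, so no Christoffel symbols enter: the Hessian of the restriction is
    the second form in the direction w, plus 2 (J B) (J B)^T.  Its trace
    against the inverse metric is nonpositive because the point is a maximum,
    but the first summand has trace 0 by minimality and the second has positive
    trace as soon as J B is nonzero. *)
Lemma minimal_no_interior_max (R : realType) (m q r : nat) (U : set 'rV[R]_m)
    (g : 'rV[R]_m -> 'rV[R]_q) u (B : 'M[R]_(q, r)) (b : 'rV[R]_q) :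
  open U -> U u -> smooth_on U g -> row_free ('J g u) ->
  (forall nu, dotv nu nu = 1 -> (forall v, dotv (v *m 'J g u) nu = 0) ->
    \tr (invmx ('J g u *m ('J g u)^T) *m
      \matrix_(i, j) dotv ('D_(delta_mx 0 i) ('D_(delta_mx 0 j) g) u) nu)
    = 0) ->
  'J g u *m B != 0 ->
  ~ (\forall y \near u, quadf B b (g y) <= quadf B b (g u)).
Proof.
move=> Uo Uu gs Jf H0 JB gmax.
set J := 'J g u in Jf H0 JB; set w := quadf_grad B b (g u).
have line v : (fun t : R => t *: v + u) @ 0 --> u := @cvg_line R _ u v.
have gd y v : U y -> is_derive y v g ('D_v g y).
  by move=> Uy; apply/derivableP/diff_derivable; exact: (gs [::]).
have le0 v : dotv (v *m J) w <= 0.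
  have : is_derive u v (quadf B b \o g) (dotv (v *m J) w).
    apply: is_derive_quadf; rewrite /J -deriveEjacobian; last exact: (gs [::]).
    exact: gd.
  move=> /derive_le0_right; apply.
  by apply: cvg_within; exact: line v _ gmax.
have crit v : dotv (v *m J) w = 0.
  apply/eqP; rewrite eq_le le0 /=.
  by have := le0 (- v); rewrite mulNmx -scaleN1r dotvZl mulN1r oppr_le0.
set S := \matrix_(i, j) dotv ('D_(delta_mx 0 i) ('D_(delta_mx 0 j) g) u) w.
have trS : \tr (invmx (J *m J^T) *m S) = 0.
  (* Unless it vanishes, w is a multiple of a unit normal. *)
  have [w0|w0] := eqVneq w 0.
    have -> : S = 0 by apply/matrixP => i j; rewrite !mxE w0 dotvE big1 // =>
      k _; rewrite mxE mulr0.
    by rewrite mulmx0 mxtrace0.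
  have ew0 : enorm w != 0 by rewrite -sqrf_eq0 sqr_enorm dotv_eq0.
  have -> : S = enorm w *: \matrix_(i, j)
      dotv ('D_(delta_mx 0 i) ('D_(delta_mx 0 j) g) u) ((enorm w)^-1 *: w).
    by apply/matrixP => i j; rewrite !mxE dotvZr mulVKf.
  rewrite -scalemxAr mxtraceZ H0 ?mulr0 ?dotv_unit // => v.
  by rewrite dotvZr crit mulr0.
have hess (v : 'rV[R]_m) :
    (v *m (S + 2 *: (J *m B *m (J *m B)^T)) *m v^T) 0 0 <= 0.
  have -> : (v *m (S + 2 *: (J *m B *m (J *m B)^T)) *m v^T) 0 0 =
      dotv ('D_v ('D_v g) u) w + 2 * dotv (v *m J *m B) (v *m J *m B).
    rewrite mulmxDr mulmxDl mxE; congr (_ + _); last first.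
      by rewrite -scalemxAr -scalemxAl mxE /dotv !trmx_mul !mulmxA.
    rewrite (derive2_sum v Uo Uu gs) /dotv mulmx_suml summxE mxE.
    under eq_bigr => j _ do rewrite mxE mulr_suml.
    rewrite exchange_big /=; apply: eq_bigr => i _.
    rewrite mulmx_suml summxE; apply: eq_bigr => j _.
    by rewrite -scalemxAl ![in LHS]mxE [RHS]mxE mulrAC.
  pose f t := quadf B b (g (t *: v + u)).
  pose f' (t : R) :=
    dotv ('D_v g (t *: v + u)) (quadf_grad B b (g (t *: v + u))).
  have Unear : \forall t \near (0 : R), U (t *: v + u).
    by apply: (line v); exact: open_nbhs_nbhs.
  have u0 : (0 : R) *: v + u = u by rewrite scale0r add0r.
  have gv : 'D_v g u = v *m J by rewrite deriveEjacobian //; exact: (gs [::]).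
  apply: (@second_derive_le0 R f f').
  - near=> t; apply: (is_derive_line (f := quadf B b \o g)).
    by apply: is_derive_quadf; apply: gd; near: t.
  - apply: (is_derive_line
      (f := fun y => dotv ('D_v g y) (quadf_grad B b (g y)))).
    rewrite u0 -gv; apply: is_derive_quadf_grad; first exact: gd.
    by apply/derivableP/diff_derivable; exact: (gs [:: v]).
  - by rewrite /f' u0 gv crit.
  - by rewrite /f u0; exact: line v _ gmax.
have := mxtrace_inv_gram_le0 Jf hess.
rewrite mulmxDr mxtraceD trS add0r -scalemxAr mxtraceZ.
by rewrite leNgt mulr_gt0 // mxtrace_inv_gram_gt0.
Unshelve. all: by end_near. Qed.

(** * Horizontal and vertical parts *)

Section Split.
Variables (R : realType) (n : nat).

(** The matrix of the projection X = (x, z) |-> x, acting on the right. *)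
Definition xinj : 'M[R]_(n + 1, n) := col_mx 1%:M 0.

Lemma mulmx_xinj (m : nat) (A : 'M[R]_(m, n + 1)) : A *m xinj = lsubmx A.
Proof.
by rewrite -{1}(hsubmxK A) mul_row_col mulmx1 mulmx0 addr0.
Qed.

Lemma dotv_zdir (X : 'rV[R]_(n + 1)) c :
  dotv X (row_mx 0 c%:M) = c * zpart X.
Proof.
rewrite /dotv -{1}(hsubmxK X) tr_row_mx mul_row_col trmx0 mulmx0 add0r.
by rewrite tr_scalar_mx mul_mx_scalar mxE.
Qed.

Lemma quadf_xinj c X :
  quadf xinj (row_mx 0 c%:M) X = enorm (xpart X) ^+ 2 + c * zpart X.
Proof. by rewrite /quadf mulmx_xinj sqr_enorm dotv_zdir. Qed.

(** A tangent space of dimension at least 2 is not contained in the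
    z-axis. *)
Lemma row_free_lsubmx_neq0 (m : nat) (J : 'M[R]_(m, n + 1)) :
  (2 <= m)%N -> row_free J -> lsubmx J != 0.
Proof.
move=> m2 /eqP Jr; apply/eqP => J0; move: m2.
have -> : m = \rank (rsubmx J *m row_mx (0 : 'M[R]_(1, n)) 1%:M).
  by rewrite mul_mx_row mulmx0 mulmx1 -J0 hsubmxK.
by rewrite ltnNge (leq_trans (mxrankM_maxl _ _)) // rank_leq_col.
Qed.

End Split.

Lemma quadf_continuous (R : realType) (q r : nat) (B : 'M[R]_(q, r)) b :
  continuous (quadf B b).
Proof.
have dotc (k : nat) (f g : 'rV[R]_q -> 'rV[R]_k) :
    (forall i, continuous (fun X => f X 0 i)) ->
    (forall i, continuous (fun X => g X 0 i)) ->
    continuous (fun X => dotv (f X) (g X)).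
  move=> fc gc; under eq_fun do rewrite dotvE.
  apply: (@continuous_big R) => [|i _ X]; first exact: add_continuous.
  exact: (cvgM (fc i X) (gc i X)).
have mulc (k : 'I_r) : continuous (fun X : 'rV[R]_q => (X *m B) 0 k).
  under eq_fun do rewrite mxE.
  apply: (@continuous_big R) => [|i _ X]; first exact: add_continuous.
  have Xi : continuous (fun X : 'rV[R]_q => X 0 i) by exact: coord_continuous.
  exact: (cvgM (Xi X) (cvg_cst _)).
have c1 := dotc r (mulmx^~ B) (mulmx^~ B) mulc mulc.
have c2 : continuous (fun X : 'rV[R]_q => dotv X b).
  apply: (dotc q id (cst b)) => k; first exact: coord_continuous.
  exact: cst_continuous.
by move=> X; exact: (cvgD (c1 X) (c2 X)).
Qed.

(** * Maxima on a minimal hypersurface with boundary *)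

Section Manifold.
Variables (R : realType) (n : nat) (M : manifold_with_boundary R n).
Variable F : M -> 'rV[R]_(n + 1).

Lemma smooth_local_param (c : chart R n M) p : smooth_map F ->
  atlas c -> chart_dom c p -> exists g, local_param F c p g.
Proof.
move=> Fs ac cp; have [| g gp] := Fs c ac (chart_map c p).
  by exists p.
by exists g.
Qed.

Lemma chart_map_half_space (c : chart R n M) p :
  chart_dom c p -> half_space (chart_map c p).
Proof.
move=> cp; have [W _ imE] := chart_image_open c.
have : (chart_map c @` chart_dom c) (chart_map c p) by exists p.
by rewrite imE => -[].
Qed.

(** A local parametrization is smooth on an open set W, and on the part of W in
    the half-space its values are points of the hypersurface. *)
Lemma local_param_ext (c : chart R n M) p g : local_param F c p g ->
  exists W : set 'rV[R]_n, [/\ open W, W (chart_map c p), smooth_on W g &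
    forall y, W y -> half_space y -> range F (g y)] /\
  g (chart_map c p) = F p.
Proof.
move=> [ac cp [W [Wo Wp gs gE]]].
have [W' W'o imE] := chart_image_open c.
have imp : chart_image c setT (chart_map c p) by exists p.
have gp : g (chart_map c p) = F p by rewrite gE //= chart_mapK.
exists (W `&` W'); split=> //; split.
- exact: openI.
- split=> //; have : (chart_map c @` chart_dom c) (chart_map c p) by exists p.
  by rewrite imE => -[].
- by move=> s x [Wx _]; exact: gs.
- move=> y [Wy W'y] yh.
  have : (chart_map c @` chart_dom c) y by rewrite imE.
  by move=> [q cq qy]; rewrite gE //; exists q.
Qed.

(** A point of the half-space off its boundary is interior to it. *)
Lemma half_space_interior (m : nat) (u : 'rV[R]_m) :
  half_space u -> ~ half_space_boundary u -> \forall y \near u, half_space y.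
Proof.
case: m u => [u _ _|m u uh ub]; first by near=> y; move=> -[].
have u0 : 0 < u 0 ord0.
  rewrite lt_def uh // andbT; apply/eqP => u0; apply: ub.
  by exists ord0.
have : \forall y \near u, 0 < (y : 'rV[R]_m.+1) 0 ord0.
  have := @coord_continuous R 1 m.+1 0 ord0 u.
  by move=> /cvgr_gt; apply.
apply: filterS => y y0 i i0.
by have -> : i = ord0 by [apply: val_inj]; exact: ltW.
Unshelve. all: by end_near. Qed.

Lemma minimal_max_boundary (r : nat) (B : 'M[R]_(n + 1, r)) b p :
  minimal_hypersurface F ->
  (forall J : 'M[R]_(n, n + 1), row_free J -> J *m B != 0) ->
  (forall q, quadf B b (F q) <= quadf B b (F p)) -> manifold_boundary p.
Proof.
move=> [[Fs Fi] Fm] JB pmax; apply: contrapT => pb.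
have [c ac cp] := atlas_cover p.
have [g gp] := smooth_local_param Fs ac cp.
have Jf := Fi _ _ _ gp.
have [W [[Wo Wp gs gr] gpE]] := local_param_ext gp.
have uh := chart_map_half_space cp.
apply: (minimal_no_interior_max Wo Wp gs Jf _ (JB _ Jf)).
  by move=> nu nu1 nuT; apply: (Fm c p g nu gp).
have [ub|] := pselect (half_space_boundary (chart_map c p)).
  by exfalso; apply: pb; exists c.
move=> /(half_space_interior uh) hs; near=> y.
have [| |q _ <-] := gr y; first by near: y; exact: open_nbhs_nbhs.
  by near: y.
by rewrite gpE.
Unshelve. all: by end_near. Qed.

(** First-order condition at a boundary maximum: the derivative is nonpositive
    in each direction that does not leave the half-space. *)
Lemma boundary_max_derive_le0 (r : nat) (B : 'M[R]_(n + 1, r)) b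
    (c : chart R n M) p g (v : 'rV[R]_n) : local_param F c p g ->
  (forall q, quadf B b (F q) <= quadf B b (F p)) ->
  (forall i : 'I_n, val i = 0%N -> 0 <= v 0 i) ->
  dotv (v *m 'J g (chart_map c p)) (quadf_grad B b (F p)) <= 0.
Proof.
move=> gp pmax v0; set u := chart_map c p.
have [W [[Wo Wp gs gr] gpE]] := local_param_ext gp.
have uh : half_space u by case: gp => _ cp _; exact: chart_map_half_space.
have gd : differentiable g u by exact: (gs [::]).
have : is_derive u v (quadf B b \o g)
    (dotv (v *m 'J g u) (quadf_grad B b (F p))).
  rewrite -gpE; apply: is_derive_quadf; rewrite -deriveEjacobian //.
  by apply/derivableP/diff_derivable.
move=> /derive_le0_right; apply.
have Wnear : \forall t \near (0 : R)^'+, W (t *: v + u).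
  by apply: cvg_within; apply: cvg_line; exact: open_nbhs_nbhs.
near=> t.
have [| |q _ /= <-] := gr (t *: v + u); first by near: t.
  by move=> i i0; rewrite !mxE addr_ge0 ?uh // mulr_ge0 ?v0 //.
by rewrite gpE.
Unshelve. all: by end_near. Qed.

(** A vector orthogonal to all unit normals at p is tangent: its component off
    the row space of the Jacobian would otherwise be proportional to a unit
    normal not orthogonal to it. *)
Lemma normal_orthogonal_tangent (c : chart R n M) p g (N : 'rV[R]_(n + 1)) :
  local_param F c p g -> row_free ('J g (chart_map c p)) ->
  (forall nu, unit_normal F p nu -> dotv nu N = 0) ->
  exists a, N = a *m 'J g (chart_map c p).
Proof.
move=> gp; set J := 'J _ _ => Jf NO.
pose a := N *m J^T *m invmx (J *m J^T); exists a.
pose w := N - a *m J.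
have wJ : w *m J^T = 0.
  by rewrite /w mulmxBl /a -!mulmxA mulVmx ?gram_unitmx // mulmx1 subrr.
have Jw (v : 'rV_n) : dotv (v *m J) w = 0.
  by rewrite dotv_mulmxl wJ dotvE big1 // => k _; rewrite mxE mulr0.
apply/eqP; rewrite -subr_eq0 -/w; apply: contraT => w0.
have : dotv ((enorm w)^-1 *: w) N = 0.
  apply: NO; exists c, g; split=> //; split; first exact: dotv_unit.
  by move=> v; rewrite dotvZr Jw mulr0.
have -> : N = a *m J + w by rewrite addrC subrK.
move=> /eqP; rewrite dotvZl dotvDr (dotvC w) Jw add0r mulf_eq0 dotv_eq0.
by rewrite invr_eq0 -sqrf_eq0 sqr_enorm dotv_eq0 orbb (negPf w0).
Qed.

End Manifold.

(** * The pinching cylinder *)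

Lemma compact_range_max (R : realType) (n : nat) (M : Type)
    (F : M -> 'rV[R]_n) (G : 'rV[R]_n -> R) :
  [set: M] !=set0 -> bounded_set (range F) -> closed (range F) ->
  continuous G -> exists p, forall q, G (F q) <= G (F p).
Proof.
move=> [p0 _] Fb Fc Gc.
have [| | |c + cmax] := @EVT_max_rV R n G (range F).
- by exists (F p0); exists p0.
- exact: bounded_closed_compact.
- exact: continuous_subspaceT.
rewrite inE => -[p _ pc]; exists p => q; rewrite pc; apply: cmax.
by rewrite inE; exists q.
Qed.

(** omega is strictly increasing in |z| on each side of 0; the sign of [s]
    selects the side. *)
Lemma profile_increasing (R : realType) (omega : R -> R) :
  smooth_on (~` [set` [:: (0 : R)]]) omega ->
  (forall z, z != 0 -> 0 < z * derive1 omega z) ->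
  forall s z1 z2, 0 < s * z1 -> s * z1 < s * z2 -> omega z1 < omega z2.
Proof.
move=> os om.
have od z : z != 0 -> differentiable omega z.
  by move=> z0; apply: (os [::]); rewrite /= inE; exact/negP.
have oder z : z != 0 -> derivable omega z 1.
  by move=> z0; apply: diff_derivable; exact: od.
move=> s z1 z2 sz1 sz12.
have s0 : s != 0 by apply: contraTneq sz1 => ->; rewrite mul0r ltxx.
have [sp|sn] := ltP 0 s.
  have z1p : 0 < z1 by rewrite -(pmulr_rgt0 _ sp).
  have z12 : z1 < z2 by rewrite -(ltr_pM2l sp).
  apply: (@gtr0_derive1_lt_cc R omega z1 z2);
    rewrite ?in_itv /= ?lexx ?(ltW z12) //.
  - move=> x; rewrite in_itv /= => /andP[z1x _]; apply: oder.
    by rewrite gt_eqF // (lt_trans z1p).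
  - move=> x; rewrite in_itv /= => /andP[z1x _].
    have xp := lt_trans z1p z1x.
    by rewrite -(pmulr_rgt0 _ xp) om // gt_eqF.
  - apply: derivable_within_continuous => x; rewrite in_itv /= => /andP[z1x _].
    by apply: oder; rewrite gt_eqF // (lt_le_trans z1p).
have {}sn : s < 0 by rewrite lt_neqAle s0.
have z1n : z1 < 0 by rewrite -(nmulr_rgt0 _ sn).
have z12 : z2 < z1 by rewrite -(ltr_nM2l sn).
apply: (@ltr0_derive1_lt_cc R omega z2 z1);
  rewrite ?in_itv /= ?lexx ?(ltW z12) //.
- move=> x; rewrite in_itv /= => /andP[_ xz1]; apply: oder.
  by rewrite lt_eqF // (lt_trans xz1).
- move=> x; rewrite in_itv /= => /andP[_ xz1].
  have xn := lt_trans xz1 z1n.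
  by rewrite -(nmulr_rgt0 _ xn) om // lt_eqF.
- apply: derivable_within_continuous => x; rewrite in_itv /= => /andP[_ xz1].
  by apply: oder; rewrite lt_eqF // (le_lt_trans xz1).
Qed.

Theorem proposition3p4 (R : realType) (n : nat) (omega : R -> R) (C : R)
    (n_ge2 : (2 <= n)%N)
    (omega_pinching : pinching_cylinder [:: 0] omega)
    (C_ge0 : 0 <= C)
    (omega_graph : graph_condition [:: 0] omega C)
    (omega_mono : forall z : R, z != 0 -> 0 < z * derive1 omega z) :
  ~ exists (M : manifold_with_boundary R n) (F : M -> 'rV[R]_(n + 1)),
      [/\ [set: M] !=set0,
          minimal_hypersurface F,
          supported_on_cylinder [:: 0] omega F,
          bounded_set (range F) &
          closed (range F)].
Proof.
move=> [M [F [M0 Fmin [Fbd Forth] Fbounded Fclosed]]].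
have [_ _ [omega_ge0 omega_eq0] omega_smooth _] := omega_pinching.
have omega_incr := profile_increasing omega_smooth omega_mono.
have bdE q : manifold_boundary q ->
    enorm (xpart (F q)) = omega (zpart (F q)) /\ zpart (F q) != 0.
  by move=> qb; have [|-> /=] := Fbd (F q); [exists q|rewrite inE].
have JB (J : 'M[R]_(n, n + 1)) : row_free J -> J *m xinj R n != 0.
  by move=> Jf; rewrite mulmx_xinj row_free_lsubmx_neq0.
have maxb c : exists2 p, manifold_boundary p &
    forall q, quadf (xinj R n) (row_mx 0 c%:M) (F q) <=
              quadf (xinj R n) (row_mx 0 c%:M) (F p).
  have [p pmax] := compact_range_max M0 Fbounded Fclosed
    (@quadf_continuous _ _ _ (xinj R n) (row_mx 0 c%:M)).
  by exists p => //; exact: (minimal_max_boundary Fmin JB pmax).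
have [p pb pmax] := maxb 0.
have [xpE zp0] := bdE p pb.
have xmax q : enorm (xpart (F q)) <= enorm (xpart (F p)).
  have := pmax q; rewrite !quadf_xinj !mul0r !addr0.
  by rewrite ler_pXn2r // ?nnegrE sqrtr_ge0.
pose s := Num.sg (zpart (F p)).
have sz : 0 < s * zpart (F p) by rewrite -normrEsg normr_gt0.
(* On the boundary |x| = omega z is at most omega (z p), so p is also the
   highest boundary point on its side. *)
have bdmax q : manifold_boundary q -> s * zpart (F q) <= s * zpart (F p).
  move=> qb; have [xqE _] := bdE q qb.
  rewrite leNgt; apply/negP => /(omega_incr _ _ _ sz).
  by rewrite -xqE -xpE ltNge xmax.
(* A point r maximizing |x|^2 + (A / e) s z lies on the boundary; there s z is
   at most s (z p), and the term |x|^2 <= A costs only e. *)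
have zmax q : s * zpart (F q) <= s * zpart (F p).
  apply/ler_addgt0Pr => e e0.
  pose A := enorm (xpart (F p)) ^+ 2 + 1.
  have A0 : 0 < A by rewrite ltr_wpDl // sqr_ge0.
  have [r rb rmax] := maxb (s * A / e).
  have := rmax q; rewrite !quadf_xinj => qr.
  have xr : enorm (xpart (F r)) ^+ 2 <= A.
    rewrite (@le_trans _ _ (enorm (xpart (F p)) ^+ 2)) ?lerDl //.
    by rewrite ler_pXn2r // ?nnegrE ?sqrtr_ge0.
  have xq : 0 <= enorm (xpart (F q)) ^+ 2 by exact: sqr_ge0.
  have zr := bdmax r rb.
  have {}qr : A / e * (s * zpart (F q)) <= A + A / e * (s * zpart (F p)).
    have : A / e * (s * zpart (F r)) <= A / e * (s * zpart (F p)).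
      by apply: ler_wpM2l zr; rewrite ltW // divr_gt0.
    lra.
  rewrite -(ler_pM2l (divr_gt0 A0 e0)) mulrDr [_ + A / e * e]addrC.
  by rewrite mulfVK ?gt_eqF.
have [[Fs Fi] _] := Fmin.
have [c [ac cp ub]] := pb.
have [g gp] := smooth_local_param Fs ac cp.
have Jf := Fi _ _ _ gp.
have [a aE] := normal_orthogonal_tangent gp Jf (fun nu => Forth p nu pb).
have [i0 i00 _] := ub.
(* The cylinder normal N = a J is tangent to the hypersurface.  It raises |x|
   and lowers s z, so both signs of its inward component a_0 are impossible. *)
set N := cylinder_normal omega (F p) in aE.
pose k := (Num.sqrt (1 + derive1 omega (zpart (F p)) ^+ 2))^-1.
have k0 : 0 < k by rewrite invr_gt0 sqrtr_gt0 ltr_wpDr // sqr_ge0.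
have x0 : 0 < enorm (xpart (F p)).
  rewrite lt_def sqrtr_ge0 andbT xpE; apply/eqP => /omega_eq0.
  by rewrite inE (negPf zp0).
have xN : xpart N = (k / enorm (xpart (F p))) *: xpart (F p).
  rewrite /N /cylinder_normal /xpart row_mxKl scalerA; congr (_ / _ *: _).
  by rewrite /profile_normal scale_row_mx row_mxKl !mxE eqxx mulr1.
have zN : zpart N = - (k * derive1 omega (zpart (F p))).
  rewrite /N /cylinder_normal {1}/zpart row_mxKr.
  by rewrite /profile_normal scale_row_mx row_mxKr !mxE eqxx mulr1n mulrN.
have so : 0 < s * derive1 omega (zpart (F p)).
  rewrite -(pmulr_rgt0 _ (_ : 0 < zpart (F p) ^+ 2)); last first.
    by rewrite exprn_even_gt0.
  have -> : zpart (F p) ^+ 2 * (s * derive1 omega (zpart (F p))) =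
    s * zpart (F p) * (zpart (F p) * derive1 omega (zpart (F p))) by ring.
  by rewrite mulr_gt0 // omega_mono.
have i0E (i : 'I_n) : val i = 0%N -> i = i0.
  by move=> iv; apply: val_inj; exact: etrans iv (esym i00).
have [a0|/ltW a0] := leP 0 (a 0 i0).
  have := boundary_max_derive_le0 gp pmax (v := a).
  rewrite -aE => /(_ _)/wrap[|]; first by move=> i /i0E ->.
  rewrite /quadf_grad dotvDr dotv_zdir mul0r addr0 dotvZr -dotv_mulmxl.
  rewrite !mulmx_xinj -!/(xpart _) xN dotvZl -sqr_enorm leNgt.
  by rewrite mulr_gt0 // mulr_gt0 ?exprn_gt0 // divr_gt0.
pose B0 : 'M[R]_(n + 1, n) := 0.
have quadz X : quadf B0 (row_mx 0 s%:M) X = s * zpart X.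
  rewrite /quadf mulmx0 dotv_zdir dotvE big1 ?add0r // => j _.
  by rewrite mxE mul0r.
have smax q : quadf B0 (row_mx 0 s%:M) (F q) <= quadf B0 (row_mx 0 s%:M) (F p).
  by rewrite !quadz.
have := boundary_max_derive_le0 gp smax (v := - a).
rewrite mulNmx -aE => /(_ _)/wrap[|].
  by move=> i /i0E ->; rewrite mxE oppr_ge0.
rewrite /quadf_grad mulmx0 mul0mx scaler0 add0r -scaleN1r dotvZl dotv_zdir zN.
rewrite mulrN mulN1r opprK mulrCA leNgt.
by rewrite mulr_gt0.
Qed.
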